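(* Let $f:\mathbb{R}^d\to\mathbb{R}$ be $(L_0,L_1)$-smooth, and let the stochastic gradient oracle be unbiased and satisfy the strong growth condition with constant $\rho\ge 1$, i.e. $\mathbb{E}_\xi[\|\nabla f(x,\xi)\|^2]\le \rho\|\nabla f(x)\|^2$ for all $x\in\mathbb{R}^d$. Then NSGD with any $\lambda>0$, constant step size $0<\eta\le \frac{\lambda}{L_0+L_1\lambda}$ and batch size $B\ge 64(\rho-1)$ guarantees, after $N\ge1$ iterations, $$\min_{k\in\{0,\dots,N-1\}}\mathbb{E}\big[\|\nabla f(x^k)\|\big]\le \frac{4F_0}{\eta N}+6\lambda,$$ where $F_0=f(x^0)-f^*$.
   Context: Setting: $f(x)=\mathbb{E}_{\xi\sim\mathcal D}[f(x,\xi)]$ is differentiable on $\mathbb{R}^d$, possibly non-convex, $f^*=\min_{x\in\mathbb{R}^d} f(x)$, and $\|\cdot\|$ is the Euclidean norm. The oracle returns stochastic gradients $\nabla f(x,\xi)$, $\xi\sim\mathcal D$. $(L_0,L_1)$-smoothness ($L_0,L_1\ge 0$): for all $x,y\in\mathbb{R}^d$ with $\|y-x\|\le 1/L_1$, $\|\nabla f(y)-\nabla f(x)\|\le (L_0+L_1\|\nabla f(x)\|)\|y-x\|$ (with $1/L_1=+\infty$ if $L_1=0$). Unbiasedness: $\mathbb{E}_\xi[\nabla f(x,\xi)]=\nabla f(x)$ for all $x$. NSGD: given $x^0\in\mathbb{R}^d$, integer batch size $B\ge1$, $\eta>0$, $\lambda>0$; at iteration $k$ draw fresh i.i.d. samples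 $\xi_1^k,\dots,\xi_B^k\sim\mathcal D$ (independent of the past), form $g^k=\frac1B\sum_{i=1}^B\nabla f(x^k,\xi_i^k)$, and set $x^{k+1}=x^k-\eta\,\frac{g^k}{\|g^k\|+\lambda}$. *)

(* Defs.v *)
From HB Require Import structures.
From mathcomp Require Import all_boot all_order all_algebra finmap.
From mathcomp Require Import all_classical all_reals all_analysis.

Set Implicit Arguments.
Unset Strict Implicit.
Unset Printing Implicit Defensive.

Import Order.TTheory GRing.Theory Num.Theory.
Import numFieldNormedType.Exports.

Local Open Scope classical_set_scope.
Local Open Scope ring_scope.

(* The norm that MathComp-Analysis puts on 'rV[R]_d is the max norm, hence this
   separate Euclidean norm. The two induce the same topology, so the library's
   [differentiable] is the usual notion. *)
Definition l2norm (R : realType) (d : nat) (x : 'rV[R]_d) : R :=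
  Num.sqrt (\sum_(i < d) x 0 i ^+ 2).

Definition gradient (R : realType) (d : nat) (f : 'rV[R]_d -> R)
    (x : 'rV[R]_d) : 'rV[R]_d :=
  \row_(i < d) 'D_(delta_mx 0 i) f x.

(* The radius 1 / L1 is an extended real, where 0^-1 = +oo. *)
Definition L0L1_smooth (R : realType) (d : nat) (L0 L1 : R)
    (f : 'rV[R]_d -> R) : Prop :=
  forall x y : 'rV[R]_d, ((l2norm (y - x))%:E <= L1%:E^-1)%E ->
    l2norm (gradient f y - gradient f x)
      <= (L0 + L1 * l2norm (gradient f x)) * l2norm (y - x).

(* Stochastic gradient at x for the sample xi: the gradient in x of the sample
   function F(x, xi). *)
Definition stoch_grad (R : realType) (d : nat) (Xi : Type)
    (F : 'rV[R]_d -> Xi -> R) (x : 'rV[R]_d) (xi : Xi) : 'rV[R]_d :=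
  gradient (fun y => F y xi) x.

(* The expectation of a random vector is taken coordinatewise. *)
Definition unbiased (R : realType) (d : nat) (dX : measure_display)
    (Xi : measurableType dX) (D : probability Xi R)
    (G : 'rV[R]_d -> Xi -> 'rV[R]_d) (f : 'rV[R]_d -> R) : Prop :=
  forall (x : 'rV[R]_d) (i : 'I_d),
    ('E_D[fun xi => G x xi 0%R i] = (gradient f x 0%R i)%:E)%E.

Definition strong_growth (R : realType) (d : nat) (dX : measure_display)
    (Xi : measurableType dX) (D : probability Xi R)
    (G : 'rV[R]_d -> Xi -> 'rV[R]_d) (f : 'rV[R]_d -> R) (rho : R) : Prop :=
  forall x : 'rV[R]_d,
    ('E_D[fun xi => (l2norm (G x xi) ^+ 2)%R]
       <= (rho * l2norm (gradient f x) ^+ 2)%:E)%E.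

Definition mutually_independent (R : realType) (dO dX : measure_display)
    (Omega : measurableType dO) (Xi : measurableType dX)
    (P : probability Omega R) (I : choiceType) (X : I -> Omega -> Xi) : Prop :=
  forall (J : {fset I}) (A : I -> set Xi),
    (forall i, measurable (A i)) ->
    (P (\bigcap_(i in [set` J]) (X i @^-1` A i))
       = \prod_(i <- J) P (X i @^-1` A i))%E.

(* xi k i is the i-th sample of the batch drawn at iteration k; the samples are
   all independent, across iterations as well as within a batch. *)
Definition iid_samples (R : realType) (dO dX : measure_display)
    (Omega : measurableType dO) (Xi : measurableType dX)
    (P : probability Omega R) (D : probability Xi R) (B : nat)
    (xi : nat -> 'I_B -> {RV P >-> Xi}) : Prop :=
  mutually_independent P
    (fun ki : nat * 'I_B => xi ki.1 ki.2 : Omega -> Xi) /\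
  (forall k i (A : set Xi), measurable A -> distribution P (xi k i) A = D A).

Definition batch_mean (R : realType) (d : nat) (Xi : Type)
    (G : 'rV[R]_d -> Xi -> 'rV[R]_d) (B : nat) (s : 'I_B -> Xi)
    (x : 'rV[R]_d) : 'rV[R]_d :=
  B%:R^-1 *: \sum_(i < B) G x (s i).

(* The iterates of NSGD along one realization s of the samples. *)
Fixpoint nsgd (R : realType) (d : nat) (Xi : Type)
    (G : 'rV[R]_d -> Xi -> 'rV[R]_d) (B : nat) (eta lambda : R)
    (x0 : 'rV[R]_d) (s : nat -> 'I_B -> Xi) (k : nat) : 'rV[R]_d :=
  if k is k'.+1 then
    let x := nsgd G eta lambda x0 s k' in
    let g := batch_mean G (s k') x in
    x - (eta / (l2norm g + lambda)) *: g
  else x0.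

(* Main.v *)
Require Import Defs.
From HB Require Import structures.
From mathcomp Require Import all_boot all_order all_algebra finmap.
From mathcomp Require Import all_classical all_reals all_analysis.
From mathcomp Require Import measurable_realfun ring lra.

Set Implicit Arguments.
Unset Strict Implicit.
Unset Printing Implicit Defensive.

Import Order.TTheory GRing.Theory Num.Theory.
Import numFieldNormedType.Exports.

Local Open Scope classical_set_scope.
Local Open Scope ring_scope.

(** Write [m] for the norm of the gradient at the current iterate, [g] for the
    batch mean used in the step, and [e] for the norm of the noise, the
    difference between [g] and the gradient.

    A step has length at most [eta], hence at most [1 / L1], so the quadratic
    upper bound on [f] applies to it ([smooth_descent]).  The step size
    condition makes [eta] times the local curvature [L0 + L1 * m] at most
    [lambda + m], and normalizing by [|g| + lambda] instead of by [|g|] costs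
    only [lambda] in the first-order term ([dot_normalized_ge]).  Together,
    along every realization, a step decreases [f] by at least
    [eta * m / 2 - 2 * eta * e - 3 / 2 * eta * lambda] ([nsgd_step_descent]).

    Everything then rests on the bound [E e <= E m / 8]: summing the descent
    inequality over the [N] steps leaves [eta / 4] times the sum of the [E m]
    below [F0 + 3 / 2 * eta * lambda * N], and the minimum of the [E m] is at
    most their average.

    Given the past, the noise of a batch has second moment at most
    [(rho - 1) / B * m ^+ 2 <= m ^+ 2 / 64], so Jensen's inequality for the
    conditional law would give the bound.  Conditional expectations are avoided
    in two ways.  First, [e <= 4 * e ^+ 2 / (m + eps) + (m + eps) / 16], which
    turns the bound on [e] into one on a second moment weighted by a function
    of the past; [eps > 0] protects the division where the gradient vanishes,
    and tends to 0 at the end.  Secondly, the weighted second moment of the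
    noise is computed by adding the samples of the batch one at a time
    ([weighted_noise_le]): a new sample is independent of all the others, so by
    Tonelli's theorem it can be integrated out first, everything else being
    frozen ([integral_fresh_sample_le]).

    The use of Tonelli's theorem requires joint measurability in the past and
    in the new sample.  The sample functions are measurable in the sample and
    continuous in the point, hence jointly measurable
    ([measurable_caratheodory]); their gradients are limits of difference
    quotients ([measurable_gradient]); the iterates follow by induction
    ([measurable_nsgd]). *)

(** * Euclidean geometry of row vectors *)

Definition dot (R : realType) (d : nat) (x y : 'rV[R]_d) : R :=
  \sum_(i < d) x 0 i * y 0 i.

Lemma dotC (R : realType) (d : nat) (x y : 'rV[R]_d) : dot x y = dot y x.
Proof. by apply: eq_bigr => i _; rewrite mulrC. Qed.

Lemma dotDl (R : realType) (d : nat) (x y z : 'rV[R]_d) :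
  dot (x + y) z = dot x z + dot y z.
Proof. by rewrite -big_split; apply: eq_bigr => i _; rewrite mxE mulrDl. Qed.

Lemma dotZl (R : realType) (d : nat) (a : R) (x y : 'rV[R]_d) :
  dot (a *: x) y = a * dot x y.
Proof. by rewrite /dot mulr_sumr; apply: eq_bigr => i _; rewrite mxE mulrA. Qed.

Lemma dotDr (R : realType) (d : nat) (x y z : 'rV[R]_d) :
  dot x (y + z) = dot x y + dot x z.
Proof. by rewrite dotC dotDl !(dotC x). Qed.

Lemma dotZr (R : realType) (d : nat) (a : R) (x y : 'rV[R]_d) :
  dot x (a *: y) = a * dot x y.
Proof. by rewrite dotC dotZl (dotC x). Qed.

Lemma dotNl (R : realType) (d : nat) (x y : 'rV[R]_d) :
  dot (- x) y = - dot x y.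
Proof. by rewrite -scaleN1r dotZl mulN1r. Qed.

Lemma dotNr (R : realType) (d : nat) (x y : 'rV[R]_d) :
  dot x (- y) = - dot x y.
Proof. by rewrite dotC dotNl (dotC x). Qed.

Lemma l2norm_ge0 (R : realType) (d : nat) (x : 'rV[R]_d) : 0 <= l2norm x.
Proof. exact: sqrtr_ge0. Qed.

Lemma l2norm_sqr (R : realType) (d : nat) (x : 'rV[R]_d) :
  l2norm x ^+ 2 = dot x x.
Proof.
rewrite sqr_sqrtr; last by apply: sumr_ge0 => i _; rewrite sqr_ge0.
by apply: eq_bigr => i _; rewrite expr2.
Qed.

Lemma l2norm0_eq0 (R : realType) (d : nat) (x : 'rV[R]_d) :
  l2norm x = 0 -> x = 0.
Proof.
move=> /eqP; rewrite sqrtr_eq0 => x0; apply/rowP => i; rewrite mxE.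
have : \sum_(i < d) x 0 i ^+ 2 == 0.
  by rewrite eq_le x0 sumr_ge0// => j _; exact: sqr_ge0.
rewrite psumr_eq0; last by move=> j _; exact: sqr_ge0.
by move=> /allP/(_ i (mem_index_enum i))/implyP/(_ isT); rewrite sqrf_eq0 => /eqP.
Qed.

Lemma l2norm0 (R : realType) (d : nat) : l2norm (0 : 'rV[R]_d) = 0.
Proof. by rewrite /l2norm big1 ?sqrtr0// => i _; rewrite mxE expr0n. Qed.

Lemma l2normZ (R : realType) (d : nat) (a : R) (x : 'rV[R]_d) :
  l2norm (a *: x) = `|a| * l2norm x.
Proof.
apply/eqP; rewrite -(@eqrXn2 _ 2) ?mulr_ge0 ?l2norm_ge0//.
by rewrite exprMn !l2norm_sqr dotZl dotZr mulrA real_normK ?num_real.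
Qed.

Lemma l2normN (R : realType) (d : nat) (x : 'rV[R]_d) :
  l2norm (- x) = l2norm x.
Proof. by rewrite -scaleN1r l2normZ normrN1 mul1r. Qed.

Lemma dot_le_l2norm (R : realType) (d : nat) (x y : 'rV[R]_d) :
  dot x y <= l2norm x * l2norm y.
Proof.
have [->|x0] := eqVneq x 0.
  by rewrite -(scale0r (0 : 'rV_d)) dotZl l2normZ normr0 !mul0r.
have [->|y0] := eqVneq y 0.
  by rewrite -(scale0r (0 : 'rV_d)) dotZr l2normZ normr0 !mul0r mulr0.
have xn : 0 < l2norm x.
  by rewrite lt_neqAle l2norm_ge0 andbT eq_sym; apply: contra_neq x0 => /l2norm0_eq0.
have yn : 0 < l2norm y.
  by rewrite lt_neqAle l2norm_ge0 andbT eq_sym; apply: contra_neq y0 => /l2norm0_eq0.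
(* the square of the difference of the two vectors rescaled to a common norm *)
have := sqr_ge0 (l2norm (l2norm y *: x - l2norm x *: y)).
rewrite l2norm_sqr !(dotDl, dotDr, dotZl, dotZr, dotNl, dotNr) (dotC y x).
rewrite -!l2norm_sqr => h.
rewrite -(ler_pM2l (mulr_gt0 xn yn)); nra.
Qed.

Lemma l2normD (R : realType) (d : nat) (x y : 'rV[R]_d) :
  l2norm (x + y) <= l2norm x + l2norm y.
Proof.
rewrite -(@ler_pXn2r _ 2) ?nnegrE ?addr_ge0 ?l2norm_ge0//.
rewrite l2norm_sqr !(dotDl, dotDr) (dotC y x) -!l2norm_sqr.
have := dot_le_l2norm x y; nra.
Qed.

(** * Descent under generalized smoothness *)

Lemma dotE_derive (R : realType) (d : nat) (f : 'rV[R]_d -> R)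
    (x v : 'rV[R]_d) :
  differentiable f x -> 'D_v f x = dot (gradient f x) v.
Proof.
move=> df; rewrite deriveE// [in LHS](row_sum_delta v) linear_sum.
by apply: eq_bigr => i _; rewrite linearZ/= mxE deriveE// mulrC.
Qed.

Lemma is_derive_segment (R : realType) (d : nat) (f : 'rV[R]_d -> R)
    (x v : 'rV[R]_d) (t : R) :
  (forall y, differentiable f y) ->
  is_derive t 1 (fun s : R => f (x + s *: v)) (dot (gradient f (x + t *: v)) v).
Proof.
move=> df.
rewrite -dotE_derive//.
have E : (fun h : R => h^-1 *: (f (x + (h *: 1 + t) *: v) - f (x + t *: v)))
       = (fun h : R => h^-1 *: (f (h *: v + (x + t *: v)) - f (x + t *: v))).
  by apply/funext => h; rewrite scaler1 scalerDl addrCA addrC; congr (_ *: (f _ - _)); rewrite addrC.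
split; last by rewrite /derive/= E.
rewrite /derivable/= E; exact: diff_derivable.
Qed.

(** The function [h] below, which up to a constant is the gap between [f] and
    its quadratic upper model along the segment from [x] to [x + v], is
    nonincreasing: its derivative at [t] is the pairing of [v] with the increment of the gradient,
    which smoothness bounds, minus [K * |v| ^+ 2 * t]. *)
Lemma smooth_descent (R : realType) (d : nat) (L0 L1 : R)
    (f : 'rV[R]_d -> R) (x v : 'rV[R]_d) :
  (forall y, differentiable f y) -> L0L1_smooth L0 L1 f ->
  ((l2norm v)%:E <= L1%:E^-1)%E ->
  f (x + v) <= f x + dot (gradient f x) v
    + (L0 + L1 * l2norm (gradient f x)) / 2 * l2norm v ^+ 2.
Proof.
move=> df fs vL.
set K := L0 + _.
pose h (t : R) := f (x + t *: v) - t * dot (gradient f x) v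
   - (K / 2 * l2norm v ^+ 2) * t ^+ 2.
have dh (t : R) : is_derive t 1 h (dot (gradient f (x + t *: v)) v - dot (gradient f x) v
   - (K * l2norm v ^+ 2) * t).
  have ? := is_derive_segment x v t df.
  apply: is_derive_eq; rewrite /GRing.scale/=; lra.
have : h 1 <= h 0.
  apply: (@ler0_derive1_le_cc _ h 0 1) => //.
  - move=> t; rewrite in_itv/= => /andP[t0 t1].
    rewrite derive1E (@derive_val _ _ _ _ _ _ _ (dh t)) -dotNl -dotDl.
    have tv : l2norm (x + t *: v - x) = t * l2norm v.
      by rewrite addrAC subrr add0r l2normZ gtr0_norm.
    have /fs : ((l2norm (x + t *: v - x))%:E <= L1%:E^-1)%E.
      apply: le_trans vL; rewrite lee_fin tv.
      by rewrite ler_piMl ?l2norm_ge0// ltW.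
    rewrite tv -/K => /(ler_wpM2r (l2norm_ge0 v)) hK.
    have := dot_le_l2norm (gradient f (x + t *: v) - gradient f x) v.
    by move=> /le_trans /(_ hK); lra.
  - apply: continuous_subspaceT => t; apply: differentiable_continuous.
    by apply/derivable1_diffP; have := dh t.
  - by rewrite in_itv/= ler01 lexx.
  - by rewrite in_itv/= ler01 lexx.
rewrite /h scale1r scale0r addr0; lra.
Qed.

(** * One step of normalized gradient descent *)

(** The quotient in the hypothesis is infinite when [L0] and [L1] both vanish;
    the product form covers this case too. *)
Lemma step_size_le (R : realType) (L0 L1 lambda eta : R) :
  0 <= L0 -> 0 <= L1 -> 0 < lambda -> 0 < eta ->
  (eta%:E <= lambda%:E / (L0 + L1 * lambda)%:E)%E ->
  eta * (L0 + L1 * lambda) <= lambda.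
Proof.
move=> L00 L10 l0 e0; have [->|K0] := eqVneq (L0 + L1 * lambda) 0.
  by rewrite mulr0 => _; exact: ltW.
have Kgt0 : 0 < L0 + L1 * lambda.
  by rewrite lt_neqAle eq_sym K0 addr_ge0// mulr_ge0// ltW.
by rewrite inver (negbTE K0) -EFinM lee_fin ler_pdivlMr.
Qed.

Lemma step_size_le_radius (R : realType) (L0 L1 lambda eta : R) :
  0 <= L0 -> 0 <= L1 -> 0 < lambda -> 0 < eta ->
  eta * (L0 + L1 * lambda) <= lambda -> (eta%:E <= L1%:E^-1)%E.
Proof.
move=> L00 L10 l0 e0 eK; rewrite inver; case: eqVneq => [_|L1n0].
  exact: leey.
have L1gt0 : 0 < L1 by rewrite lt_neqAle eq_sym L1n0.
rewrite lee_fin -[L1^-1]mul1r ler_pdivlMr// -(ler_pM2r l0); nra.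
Qed.

(** For [m] above [lambda] the left-hand side exceeds its value at [lambda] by
    [eta * L1 * (m - lambda)], and [eta * L1] is at most 1. *)
Lemma step_size_curvature (R : realType) (L0 L1 lambda eta m : R) :
  0 <= L0 -> 0 <= L1 -> 0 < lambda -> 0 < eta ->
  eta * (L0 + L1 * lambda) <= lambda -> 0 <= m ->
  eta * (L0 + L1 * m) <= lambda + m.
Proof.
move=> L00 L10 l0 e0 eK m0.
have eL1 : eta * L1 <= 1 by rewrite -(ler_pM2r l0); nra.
have eL1' : 0 <= eta * L1 by rewrite mulr_ge0// ltW.
have [ml|lm] := leP m lambda; nra.
Qed.

(** With [e := g - a], the numerator is [|g| ^+ 2 - dot e g], which is at least
    [|g| ^+ 2 - |e| * |g|].  After division the first term is at least
    [|g| - lambda] and the second at least [- |e|], and [|g|] is at least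
    [|a| - |e|]. *)
Lemma dot_normalized_ge (R : realType) (d : nat) (lambda : R)
    (a g : 'rV[R]_d) : 0 < lambda ->
  l2norm a - 2 * l2norm (g - a) - lambda <= dot a g / (l2norm g + lambda).
Proof.
move=> l0; set e := g - a; set r := l2norm g.
have r0 : 0 <= r := l2norm_ge0 g.
have rl : 0 < r + lambda by rewrite ltr_wpDl.
have -> : a = g - e by rewrite /e opprB addrC subrK.
have e0 := l2norm_ge0 e.
have nge : l2norm (g - e) <= r + l2norm e by rewrite (le_trans (l2normD _ _))// l2normN.
rewrite ler_pdivlMr// dotDl dotNl -l2norm_sqr -/r.
have := dot_le_l2norm e g; rewrite -/r => eg.
nra.
Qed.

Lemma nsgd_displacement_le (R : realType) (d : nat) (eta lambda : R)
    (g : 'rV[R]_d) : 0 < lambda -> 0 < eta ->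
  l2norm (- ((eta / (l2norm g + lambda)) *: g)) <= eta.
Proof.
move=> l0 e0; have r0 := l2norm_ge0 g.
have rl : 0 < l2norm g + lambda by rewrite ltr_wpDl.
rewrite l2normN l2normZ gtr0_norm ?divr_gt0//.
by rewrite mulrAC ler_pdivrMr// ler_pM2l// lerDl ltW.
Qed.

Lemma nsgd_step_descent (R : realType) (d : nat) (L0 L1 lambda eta : R)
    (f : 'rV[R]_d -> R) (x g : 'rV[R]_d) :
  (forall y, differentiable f y) -> L0L1_smooth L0 L1 f ->
  0 <= L0 -> 0 <= L1 -> 0 < lambda -> 0 < eta ->
  eta * (L0 + L1 * lambda) <= lambda ->
  f (x - (eta / (l2norm g + lambda)) *: g) <=
    f x - eta / 2 * l2norm (gradient f x)
    + 2 * eta * l2norm (g - gradient f x) + 3 / 2 * (eta * lambda).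
Proof.
move=> df fs L00 L10 l0 e0 eK.
set a := gradient f x; set v := - (_ *: g).
have vle : l2norm v <= eta := nsgd_displacement_le g l0 e0.
have radius : ((l2norm v)%:E <= L1%:E^-1)%E.
  by apply: le_trans (step_size_le_radius L00 L10 l0 e0 eK); rewrite lee_fin.
apply: (le_trans (smooth_descent x df fs radius)); rewrite -/a.
have a0 := l2norm_ge0 a.
have lin : dot a v <= - (eta * (l2norm a - 2 * l2norm (g - a) - lambda)).
  rewrite /v dotNr dotZr lerN2 -mulrA (mulrC _^-1).
  by rewrite ler_pM2l// dot_normalized_ge.
have quad : (L0 + L1 * l2norm a) / 2 * l2norm v ^+ 2
    <= eta * (lambda + l2norm a) / 2.
  have v2 : l2norm v ^+ 2 <= eta ^+ 2.
    by rewrite ler_pXn2r// nnegrE ?l2norm_ge0// ltW.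
  have K0 : 0 <= L0 + L1 * l2norm a by rewrite addr_ge0// mulr_ge0.
  have := step_size_curvature L00 L10 l0 e0 eK a0.
  rewrite -(ler_pM2l e0) => cK.
  have := ler_wpM2l K0 v2; rewrite expr2 in v2 *; nra.
lra.
Qed.

(** Smoothness over one step bounds the increment of the gradient, so a
    gradient norm can only grow geometrically along the iterates, uniformly
    over the realizations of the samples. *)
Lemma nsgd_step_gradient (R : realType) (d : nat) (L0 L1 lambda eta : R)
    (f : 'rV[R]_d -> R) (x g : 'rV[R]_d) :
  L0L1_smooth L0 L1 f ->
  0 <= L0 -> 0 <= L1 -> 0 < lambda -> 0 < eta ->
  eta * (L0 + L1 * lambda) <= lambda ->
  l2norm (gradient f (x - (eta / (l2norm g + lambda)) *: g)) <=
    2 * l2norm (gradient f x) + lambda.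
Proof.
move=> fs L00 L10 l0 e0 eK.
set a := gradient f x; set y := x - _.
have yx : l2norm (y - x) <= eta.
  by rewrite /y addrAC subrr add0r nsgd_displacement_le.
have /fs : ((l2norm (y - x))%:E <= L1%:E^-1)%E.
  by apply: le_trans (step_size_le_radius L00 L10 l0 e0 eK); rewrite lee_fin.
rewrite -/a => h.
have a0 := l2norm_ge0 a.
have K0 : 0 <= L0 + L1 * l2norm a by rewrite addr_ge0// mulr_ge0.
have := step_size_curvature L00 L10 l0 e0 eK a0.
have := l2normD (gradient f y - a) a; rewrite subrK.
have := ler_wpM2l K0 yx; lra.
Qed.

(** * Joint measurability of sample functions, gradients and iterates *)

Definition grid_round (R : realType) (d : nat) (n : nat) (z : 'rV[int]_d) :
    'rV[R]_d :=
  \row_(i < d) ((z 0 i)%:~R / n.+1%:R).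

Definition grid_floor (R : realType) (d : nat) (n : nat) (x : 'rV[R]_d) :
    'rV[int]_d :=
  \row_(i < d) Num.floor (x 0 i * n.+1%:R).

Lemma cvg_grid (R : realType) (d : nat) (x : 'rV[R]_d) :
  grid_round R n (grid_floor n x) @[n --> \oo] --> x.
Proof.
apply/cvg_ballP => e e0; near=> n; split=> // i j.
rewrite !mxE ord1.
set a := x 0 j; rewrite /ball/=.
have n0 : (0 : R) < n.+1%:R by [].
have ne : n.+1%:R^-1 < e by near: n; exact: (near_infty_natSinv_lt (PosNum e0)).
apply: le_lt_trans ne.
set N := n.+1%:R in n0 *; set z := Num.floor _.
have -> : a - z%:~R / N = (a * N - z%:~R) / N.
  by rewrite mulrBl mulfK ?lt0r_neq0.
rewrite normrM normfV (gtr0_norm n0) -[leRHS]mul1r ler_pM2r ?invr_gt0//.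
have /andP[f1 f2] := floor_itv (a * N).
rewrite ger0_norm ?subr_ge0// lerBlDl; apply: ltW; move: f2.
by rewrite intrD.
Unshelve. all: by end_near. Qed.

(** Rounding the point to a grid of mesh [1 / n.+1] gives a function that is
    glued from countably many sections [H y], one on each cell of the grid, and
    is therefore measurable; by continuity in the point these functions
    converge to the original one. *)
Lemma measurable_caratheodory (R : realType) (d : nat) (dT : measure_display)
    (T : measurableType dT) (x : T -> 'rV[R]_d) (H : 'rV[R]_d -> T -> R) :
  (forall i, measurable_fun setT (fun t => x t 0 i)) ->
  (forall y, measurable_fun setT (H y)) ->
  (forall t, continuous (H ^~ t)) ->
  measurable_fun setT (fun t => H (x t) t).
Proof.
move=> mx mH cH.
apply: (measurable_fun_cvg (h := fun n t => H (grid_round R n (grid_floor n (x t))) t)); last first.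
  by move=> t _; exact: (continuous_cvg _ (@cH t (x t)) (@cvg_grid _ _ (x t))).
move=> n _ A mA; rewrite setTI.
rewrite [X in measurable X](_ : _ = \bigcup_(q : 'rV[int]_d)
  ((\bigcap_(i in [set: 'I_d])
     [set t | (q 0 i)%:~R <= x t 0 i * n.+1%:R < (q 0 i + 1)%:~R])
   `&` (H (grid_round R n q) @^-1` A))); last first.
  apply/seteqP; split=> t /=.
    move=> At; exists (grid_floor n (x t)) => //; split=> // i _ /=.
    by rewrite mxE floor_itv.
  move=> [q _ [qt]]; suff -> : grid_floor n (x t) = q by [].
  by apply/rowP => i; rewrite mxE; apply/eqP; rewrite floor_eq; exact: qt.
apply: countable_bigcupT_measurable => // q; apply: measurableI; last first.
  by rewrite -[X in measurable X]setTI; exact: mH.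
apply: fin_bigcap_measurable => // i _.
rewrite -[X in measurable X]setTI.
rewrite [X in measurable (_ `&` X)](_ : _ =
  (fun t => x t 0 i * n.+1%:R) @^-1` `[(q 0 i)%:~R, (q 0 i + 1)%:~R[%classic).
  by apply: measurable_funM => //; exact: mx.
by apply/seteqP; split=> t /=; rewrite in_itv.
Qed.

(** Each coordinate is the limit of difference quotients along the steps
    [1 / n.+1], and these are measurable by [measurable_caratheodory]. *)
Lemma measurable_gradient (R : realType) (d : nat) (dT : measure_display)
    (T : measurableType dT) (x : T -> 'rV[R]_d) (H : 'rV[R]_d -> T -> R) :
  (forall i, measurable_fun setT (fun t => x t 0 i)) ->
  (forall y, measurable_fun setT (H y)) ->
  (forall t y, differentiable (H ^~ t) y) ->
  forall i, measurable_fun setT (fun t => gradient (H ^~ t) (x t) 0 i).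
Proof.
move=> mx mH dH i.
have cH t : continuous (H ^~ t).
  by move=> y; exact: differentiable_continuous.
pose e : 'rV[R]_d := delta_mx 0 i.
apply: (measurable_fun_cvg (h := fun n t => (harmonic n)^-1 *
    (H (harmonic n *: e + x t) t - H (x t) t))); last first.
  move=> t _; rewrite mxE.
  have /cvgr_dnbhsP : (fun h : R => h^-1 *: (H (h *: e + x t) t - H (x t) t)) @ 0^'
      --> 'D_e (H ^~ t) (x t).
    exact: (diff_derivable (dH t (x t))).
  move=> /(_ harmonic); apply; split; last exact: cvg_harmonic.
  by move=> n; rewrite gt_eqF// harmonic_gt0.
move=> n; apply: measurable_funM => //; apply: measurable_funB.
  apply: (measurable_caratheodory (x := fun t => harmonic n *: e + x t)) => //.
  move=> j.
  rewrite (_ : (fun t => _) = (fun t => harmonic n * e 0 j + x t 0 j)).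
    by apply: measurable_funD => //; exact: mx.
  by apply/funext => t; rewrite !mxE.
exact: measurable_caratheodory.
Qed.

Lemma measurable_l2norm (R : realType) (d : nat) (dT : measure_display)
    (T : measurableType dT) (x : T -> 'rV[R]_d) :
  (forall i, measurable_fun setT (fun t => x t 0 i)) ->
  measurable_fun setT (fun t => l2norm (x t)).
Proof.
move=> mx; rewrite /l2norm.
apply: (measurableT_comp (f := @Num.sqrt R)).
  by apply: continuous_measurable_fun; exact: sqrt_continuous.
by apply: measurable_sum => i; exact: measurable_funX.
Qed.

Lemma measurable_l2normB (R : realType) (d : nat) (dT : measure_display)
    (T : measurableType dT) (x y : T -> 'rV[R]_d) :
  (forall i, measurable_fun setT (fun t => x t 0 i)) ->
  (forall i, measurable_fun setT (fun t => y t 0 i)) ->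
  measurable_fun setT (fun t => l2norm (x t - y t)).
Proof.
move=> mx my; apply: measurable_l2norm => i.
rewrite (_ : (fun t => _) = (fun t => x t 0 i - y t 0 i)).
  exact: measurable_funB.
by apply/funext => t; rewrite !mxE.
Qed.

Lemma measurable_stoch_grad (R : realType) (d : nat) (dX dT : measure_display)
    (Xi : measurableType dX) (T : measurableType dT)
    (F : 'rV[R]_d -> Xi -> R) (x : T -> 'rV[R]_d) (s : T -> Xi) :
  (forall y, measurable_fun setT (F y)) ->
  (forall u y, differentiable (F ^~ u) y) ->
  (forall i, measurable_fun setT (fun t => x t 0 i)) ->
  measurable_fun setT s ->
  forall i, measurable_fun setT (fun t => stoch_grad F (x t) (s t) 0 i).
Proof.
move=> mF dF mx ms i.
apply: (@measurable_gradient _ _ _ _ x (fun y t => F y (s t))) => //.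
by move=> y; exact: measurableT_comp.
Qed.

Lemma measurable_batch_mean (R : realType) (d : nat)
    (dX dT : measure_display) (Xi : measurableType dX) (T : measurableType dT)
    (F : 'rV[R]_d -> Xi -> R) (B : nat) (x : T -> 'rV[R]_d)
    (s : 'I_B -> T -> Xi) :
  (forall y, measurable_fun setT (F y)) ->
  (forall u y, differentiable (F ^~ u) y) ->
  (forall i, measurable_fun setT (fun t => x t 0 i)) ->
  (forall j, measurable_fun setT (s j)) ->
  forall i, measurable_fun setT
    (fun t => batch_mean (stoch_grad F) (fun j => s j t) (x t) 0 i).
Proof.
move=> mF dF mx ms i; rewrite (_ : (fun t => _) = (fun t => B%:R^-1 *
    \sum_(j < B) stoch_grad F (x t) (s j t) 0 i)).
  apply: measurable_funM => //; apply: measurable_sum => j.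
  exact: measurable_stoch_grad.
by apply/funext => t; rewrite mxE summxE.
Qed.

Lemma measurable_ge0_inv (R : realType) (dT : measure_display)
    (T : measurableType dT) (u : T -> R) :
  (forall t, 0 <= u t) -> measurable_fun setT u ->
  measurable_fun setT (fun t => (u t)^-1).
Proof.
move=> u0 mu; rewrite (_ : (fun t => _) = (fun t => u t `^ (-1))).
  exact: (measurableT_comp (measurable_powR _)).
by apply/funext => t; rewrite powR_inv1.
Qed.

(** The source space [T] is arbitrary because the iterates have to be measurable
    also for the sigma-algebra generated by some of the samples only. *)
Lemma measurable_nsgd (R : realType) (d : nat) (dX dT : measure_display)
    (Xi : measurableType dX) (T : measurableType dT)
    (F : 'rV[R]_d -> Xi -> R) (B : nat) (eta lambda : R) (x0 : 'rV[R]_d)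
    (s : nat -> 'I_B -> T -> Xi) (k : nat) :
  (forall y, measurable_fun setT (F y)) ->
  (forall u y, differentiable (F ^~ u) y) ->
  0 < lambda ->
  (forall j i, (j < k)%N -> measurable_fun setT (s j i)) ->
  forall i, measurable_fun setT (fun t =>
    nsgd (stoch_grad F) eta lambda x0 (fun j i => s j i t) k 0 i).
Proof.
move=> mF dF l0; elim: k => [_ i|k IH ms i] /=; first exact: measurable_cst.
have mx : forall i, measurable_fun setT (fun t =>
    nsgd (stoch_grad F) eta lambda x0 (fun j i => s j i t) k 0 i).
  by apply: IH => j i' jk; apply: ms; rewrite ltnS ltnW.
set x := nsgd _ _ _ _ in mx *.
have mg : forall i, measurable_fun setT (fun t =>
    batch_mean (stoch_grad F) (fun i => s k i t) (x (fun j i => s j i t) k) 0 i).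
  by move=> j; apply: measurable_batch_mean => // i'; exact: ms.
set g := (fun t : T => batch_mean (stoch_grad F) (fun i => s k i t)
  (x (fun j i => s j i t) k)) in mg.
rewrite (_ : (fun t => _) = (fun t => x (fun j i => s j i t) k 0 i
    - eta * (l2norm (g t) + lambda)^-1 * g t 0 i)); last first.
  by apply/funext => t; rewrite !mxE.
apply: measurable_funB; first exact: mx.
apply: measurable_funM; last exact: mg.
apply: measurable_funM => //; apply: measurable_ge0_inv.
  by move=> t; rewrite addr_ge0 ?l2norm_ge0// ltW.
by apply: measurable_funD => //; exact: measurable_l2norm.
Qed.

(** * Integrating out a fresh sample *)

(** The hypothesis identifies the law of the pair on rectangles, hence
    everywhere, as a product; the rest is Tonelli's theorem. *)
Lemma integral_indep_pair (R : realType) (dO dT dX : measure_display)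
    (Omega : measurableType dO) (T : measurableType dT)
    (Xi : measurableType dX) (P : probability Omega R) (D : probability Xi R)
    (U : Omega -> T) (V : Omega -> Xi) (h : T * Xi -> \bar R) :
  measurable_fun setT U -> measurable_fun setT V ->
  (forall A C, measurable A -> measurable C ->
    P (U @^-1` A `&` V @^-1` C) = (P (U @^-1` A) * D C)%E) ->
  measurable_fun setT h -> (forall z, (0 <= h z)%E) ->
  (\int[P]_w h (U w, V w) = \int[P]_w \int[D]_s h (U w, s))%E.
Proof.
move=> mU mV indep mh h0.
pose U' : {mfun Omega >-> T} := HB.pack U (isMeasurableFun.Build _ _ _ _ _ mU).
pose mu : probability T R := distribution P U'.
have mUV : measurable_fun setT (fun w => (U w, V w)) by exact: measurable_fun_pair.
pose UV : {mfun Omega >-> (T * Xi)%type} :=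
  HB.pack (fun w => (U w, V w)) (isMeasurableFun.Build _ _ _ _ _ mUV).
pose m' : probability (T * Xi)%type R := distribution P UV.
have := @ge0_integral_pushforward _ _ _ _ _ _ mUV P setT h measurableT mh
  (fun z _ => h0 z).
rewrite preimage_setT => <-.
have m'E : forall X, measurable X -> (mu \x D)%E X = m' X.
  by apply: product_measure_unique => A C mA mC; rewrite -indep.
rewrite (@eq_measure_integral _ _ _ _ (mu \x D)%E m'); last first.
  by move=> X mX _; exact/esym/m'E.
rewrite fubini_tonelli1//.
have mG := @measurable_fun_fubini_tonelli_F _ _ _ _ _ D h mh h0.
have := @ge0_integral_pushforward _ _ _ _ _ _ mU P setT _ measurableT mG.
rewrite preimage_setT => <-//.
by move=> t _; apply: integral_ge0.
Qed.

(** A pi-system generating the sigma-algebra of all variables other than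
    [X j]. *)
Definition other_events (dO dX : measure_display)
    (Omega : measurableType dO) (Xi : measurableType dX) (I : choiceType)
    (X : I -> Omega -> Xi) (j : I) : set (set Omega) :=
  [set E | exists (J : {fset I}) (A : I -> set Xi),
    [/\ j \notin J, (forall i, measurable (A i))
      & E = \bigcap_(i in [set` J]) (X i @^-1` A i)]].

Lemma other_events_measurable (dO dX : measure_display)
    (Omega : measurableType dO) (Xi : measurableType dX) (I : choiceType)
    (X : I -> Omega -> Xi) (j : I) :
  (forall i, measurable_fun setT (X i)) ->
  other_events X j `<=` measurable.
Proof.
move=> mX _ [J [A [_ mA ->]]]; apply: fin_bigcap_measurable.
  exact: finite_fset.
by move=> i _; rewrite -[X in measurable X]setTI; exact: mX.
Qed.

Lemma other_events_setI (dO dX : measure_display)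
    (Omega : measurableType dO) (Xi : measurableType dX) (I : choiceType)
    (X : I -> Omega -> Xi) (j : I) : setI_closed (other_events X j).
Proof.
move=> _ _ [J1 [A1 [jJ1 mA1 ->]]] [J2 [A2 [jJ2 mA2 ->]]].
exists (J1 `|` J2)%fset, (fun i => (if i \in J1 then A1 i else setT) `&`
  (if i \in J2 then A2 i else setT)); split.
- by rewrite inE negb_or jJ1.
- by move=> i; apply: measurableI; case: ifP.
- apply/seteqP; split=> w /=.
    by move=> [w1 w2] i /= _; split; case: ifPn => // iJ; [exact: w1|exact: w2].
  move=> w12; split=> i iJ /=.
    by have := w12 i; rewrite /= inE iJ => /(_ isT)[].
  by have := w12 i; rewrite /= inE iJ orbT => /(_ isT)[].
Qed.

(** For fixed [C], both sides are finite measures in [E].  On the pi-system they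
    agree by mutual independence, applied to the finite family enlarged by
    [j]. *)
Lemma fresh_sample_indep (R : realType) (dO dX : measure_display)
    (Omega : measurableType dO) (Xi : measurableType dX)
    (P : probability Omega R) (I : choiceType) (X : I -> Omega -> Xi) (j : I) :
  (forall i, measurable_fun setT (X i)) -> mutually_independent P X ->
  forall E C, <<s other_events X j >> E -> measurable C ->
    P (E `&` X j @^-1` C) = (P E * P (X j @^-1` C))%E.
Proof.
move=> mX indep E C sE mC.
have mXC : measurable (X j @^-1` C) by rewrite -[X in measurable X]setTI; exact: mX.
have PXC : (P (X j @^-1` C) = (fine (P (X j @^-1` C)))%:E)%E.
  by rewrite fineK// fin_num_measure.
have c0 : 0 <= fine (P (X j @^-1` C)) by rewrite fine_ge0.
rewrite muleC PXC.
apply: (@g_sigma_algebra_measure_unique _ _ _ (other_events X j) _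
  (fun _ => setT) _ _ (mrestr P mXC) (mscale (NngNum c0) P)) => //.
- exact: other_events_measurable.
- move=> _; exists fset0, (fun _ => setT); split=> //.
  by apply/seteqP; split=> // w _ i; rewrite /= inE.
- by rewrite bigcup_const.
- exact: other_events_setI.
- move=> _ [J [A [jJ mA ->]]]; 
  rewrite -[LHS]/(P (_ `&` X j @^-1` C)).
  rewrite -[RHS]/((fine (P (X j @^-1` C)))%:E * P _)%E -PXC.
  pose A' i := if i == j then C else A i.
  have mA' i : measurable (A' i) by rewrite /A'; case: ifP.
  have A'A i : i \in J -> A' i = A i.
    by rewrite /A'; case: eqP => // ->; rewrite (negbTE jJ).
  have := indep (j |` J)%fset A' mA'; rewrite big_fsetU1// {2}/A' eqxx.
  have -> : (\prod_(i <- J) P (X i @^-1` A' i) =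
             \prod_(i <- J) P (X i @^-1` A i))%E.
    by apply: eq_big_seq => i iJ; rewrite A'A.
  rewrite -indep// => <-; congr (P _); apply/seteqP; split=> w /=.
    move=> [wA wC] i /=; rewrite !inE => /orP[/eqP ->|iJ].
      by rewrite /A' eqxx.
    by rewrite A'A//; exact: wA.
  move=> wA; split; last by have := wA j; rewrite /= !inE eqxx /A' eqxx; exact.
  by move=> i /= iJ; have := wA i; rewrite /= !inE iJ orbT A'A//; exact.
- move=> _; rewrite -[X in (X < _)%E]/(P (_ `&` X j @^-1` C)).
  by rewrite ltey_eq fin_num_measure//; exact: measurableI.
Qed.

(** The sample space with the sigma-algebra of all variables other than [X j]. *)
Notation other_space X j := (g_sigma_algebraType (other_events X j)).

Lemma measurable_other_sample (dO dX : measure_display)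
    (Omega : measurableType dO) (Xi : measurableType dX) (I : choiceType)
    (X : I -> Omega -> Xi) (i j : I) :
  i != j -> measurable_fun [set: other_space X j] (X i).
Proof.
move=> ij _ A mA; rewrite setTI; apply: sub_sigma_algebra.
exists [fset i]%fset, (fun _ => A); split => //; first by rewrite inE eq_sym.
apply/seteqP; split=> w /=; last by move=> /(_ i); apply; rewrite /= inE.
by move=> wA k; rewrite /= inE => /eqP ->.
Qed.

Lemma measurable_other_space (dO dX dY : measure_display)
    (Omega : measurableType dO) (Xi : measurableType dX)
    (Y : measurableType dY) (I : choiceType)
    (X : I -> Omega -> Xi) (j : I) (u : Omega -> Y) :
  (forall i, measurable_fun setT (X i)) ->
  measurable_fun [set: other_space X j] u -> measurable_fun [set: Omega] u.
Proof.
move=> mX mu _ A mA.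
exact: (smallest_sub (@sigma_algebra_measurable _ Omega)
  (@other_events_measurable _ _ _ _ _ _ j mX) (mu measurableT A mA)).
Qed.

(** The integrand sees the realization twice, directly and through [X j].
    Because its first argument only carries the information of the other
    variables, it is independent of the second one, and [u] has only to
    dominate the integral over a new sample with the realization fixed. *)
Lemma integral_fresh_sample_le (R : realType) (dO dX : measure_display)
    (Omega : measurableType dO) (Xi : measurableType dX)
    (P : probability Omega R) (D : probability Xi R) (I : choiceType)
    (X : I -> Omega -> Xi) (j : I) (h : Omega * Xi -> \bar R)
    (u : Omega -> \bar R) :
  (forall i, measurable_fun setT (X i)) -> mutually_independent P X ->
  (forall C, measurable C -> P (X j @^-1` C) = D C) ->
  measurable_fun [set: other_space X j * Xi] h -> (forall z, (0 <= h z)%E) ->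
  measurable_fun [set: other_space X j] u ->
  (forall w, \int[D]_s h (w, s) <= u w)%E ->
  (\int[P]_w h (w, X j w) <= \int[P]_w u w)%E.
Proof.
move=> mX indep XD mh h0 mu hu.
pose T : measurableType _ := other_space X j.
pose id' : Omega -> T := id.
have mid : measurable_fun setT id'.
  by apply: (measurable_other_space mX); exact: measurable_id.
rewrite (@integral_indep_pair _ _ _ _ Omega T Xi P D id' (X j) h)//.
- apply: ge0_le_integral => //.
  + by move=> w _; apply: integral_ge0 => s _; exact: h0.
  + apply: (measurable_other_space mX).
    exact: (@measurable_fun_fubini_tonelli_F _ _ T Xi R D h mh h0).
  + exact: (measurable_other_space mX mu).
- move=> A C mA mC; rewrite -XD//; exact: fresh_sample_indep.
Qed.

(** * Second moment of the batch noise *)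

(** Expanding the square, the cross term integrates to [2 * dot a m].  The
    coordinates of [Z] are integrable because [|Z_i| <= 1 + |Z| ^+ 2]. *)
Lemma second_moment_shift (R : realType) (d : nat) (dX : measure_display)
    (Xi : measurableType dX) (D : probability Xi R) (Z : Xi -> 'rV[R]_d)
    (a m : 'rV[R]_d) (v : R) :
  (forall i, measurable_fun setT (fun s => Z s 0 i)) ->
  (forall i, \int[D]_s (Z s 0 i)%:E = (m 0 i)%:E)%E ->
  (\int[D]_s (l2norm (Z s) ^+ 2)%:E <= v%:E)%E ->
  (\int[D]_s (l2norm (a + Z s) ^+ 2)%:E
    <= (l2norm (a + m) ^+ 2 + (v - l2norm m ^+ 2))%:E)%E.
Proof.
move=> mZ EZ EZ2.
have mZ2 : measurable_fun setT (fun s => l2norm (Z s) ^+ 2).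
  by apply: measurable_funX; exact: measurable_l2norm.
have iZ2 : D.-integrable setT (EFin \o (fun s => l2norm (Z s) ^+ 2)).
  apply/integrableP; split; first exact/measurable_EFinP.
  apply: (@le_lt_trans _ _ v%:E); last exact: ltry.
  apply: le_trans EZ2; apply: ge0_le_integral => //=.
  - by apply/measurable_EFinP; apply: measurableT_comp.
  - exact/measurable_EFinP.
  - by move=> s _; rewrite ger0_norm ?sqr_ge0.
have iZ i : D.-integrable setT (fun s => (Z s 0 i)%:E).
  apply: (@le_integrable _ _ _ _ _ _ _
    (EFin \o (fun s => 1 + l2norm (Z s) ^+ 2))) => //.
  - exact/measurable_EFinP.
  - move=> s _ /=; rewrite lee_fin [leRHS]ger0_norm ?addr_ge0 ?sqr_ge0//.
    have : Z s 0 i ^+ 2 <= l2norm (Z s) ^+ 2.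
      rewrite l2norm_sqr /dot (bigD1 i)//= expr2 lerDl.
      by apply: sumr_ge0 => k _; rewrite -expr2 sqr_ge0.
    rewrite -(real_normK (num_real (Z s 0 i))).
    have := sqr_ge0 (`|Z s 0 i| - 1); nra.
  - by apply: (integrableD _ (finite_measure_integrable_cst D 1 _) iZ2).
rewrite [leLHS](_ : _ = \int[D]_s (((l2norm a ^+ 2)%:E
   + \sum_(i < d) ((2 * a 0 i)%:E * (Z s 0 i)%:E)) + (l2norm (Z s) ^+ 2)%:E))%E; last first.
  apply: eq_integral => s _; rewrite !l2norm_sqr dotDl !dotDr (dotC (Z s) a).
  under eq_bigr do rewrite -EFinM.
  rewrite sumEFin -!EFinD; congr (_%:E).
  rewrite (_ : \sum_(i < d) _ = 2 * dot a (Z s)); first by ring.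
  by rewrite mulr_sumr; apply: eq_bigr => i _; rewrite mulrA.
have iS : D.-integrable setT (fun s => \sum_(i < d) ((2 * a 0 i)%:E * (Z s 0 i)%:E))%E.
  by apply: integrable_sum => // i _; exact: integrableZl.
rewrite integralD//; last first.
  by apply: integrableD => //; exact: finite_measure_integrable_cst.
rewrite integralD//; last exact: finite_measure_integrable_cst.
rewrite integral_cst//.
rewrite [X in (_ * X + _ + _)%E](_ : _ = 1%E); last exact: probability_setT.
rewrite mule1 integral_sum//; last first.
  by move=> i; exact: integrableZl.
under eq_bigr do rewrite integralZl// EZ -EFinM.
rewrite sumEFin -EFinD.
apply: (le_trans (leeD2l _ EZ2)).
rewrite -EFinD lee_fin.
rewrite (_ : \sum_(i < d) _ = 2 * dot a m).
  rewrite !l2norm_sqr dotDl !dotDr (dotC m a); lra.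
by rewrite mulr_sumr; apply: eq_bigr => i _; rewrite mulrA.
Qed.

Lemma stoch_grad_second_moment (R : realType) (d : nat) (dX : measure_display)
    (Xi : measurableType dX) (D : probability Xi R)
    (F : 'rV[R]_d -> Xi -> R) (f : 'rV[R]_d -> R) (rho : R) (a x : 'rV[R]_d) :
  (forall y, measurable_fun setT (F y)) ->
  (forall u y, differentiable (F ^~ u) y) ->
  unbiased D (stoch_grad F) f -> strong_growth D (stoch_grad F) f rho ->
  (\int[D]_s (l2norm (a + (stoch_grad F x s - gradient f x)) ^+ 2)%:E
    <= (l2norm a ^+ 2 + (rho - 1) * l2norm (gradient f x) ^+ 2)%:E)%E.
Proof.
move=> mF dF unb sgc; set m := gradient f x.
have -> : l2norm a ^+ 2 + (rho - 1) * l2norm m ^+ 2 =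
    l2norm (a - m + m) ^+ 2 + (rho * l2norm m ^+ 2 - l2norm m ^+ 2).
  by rewrite subrK; ring.
under eq_integral do rewrite addrCA addrC.
apply: second_moment_shift => [i|i|].
- apply: (measurable_stoch_grad (x := fun _ => x) (s := id)) => //.
- by have := unb x i; rewrite unlock.
- by have := sgc x; rewrite unlock.
Qed.

(** Induction over the samples of the batch.  The weight [c], the point [x] and
    the noise of the other samples do not depend on the sample being added; by
    [stoch_grad_second_moment] integrating it out adds at most
    [(rho - 1) * c * |gradient f x| ^+ 2], the cross term vanishing since the
    noise of the new sample is centered. *)
Lemma weighted_noise_le (R : realType) (d : nat) (dO dX : measure_display)
    (Omega : measurableType dO) (Xi : measurableType dX)
    (P : probability Omega R) (D : probability Xi R)
    (I : choiceType) (X : I -> Omega -> Xi)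
    (F : 'rV[R]_d -> Xi -> R) (f : 'rV[R]_d -> R) (rho : R)
    (x : Omega -> 'rV[R]_d) (c : Omega -> R) (js : seq I) :
  (forall i, measurable_fun setT (X i)) -> mutually_independent P X ->
  (forall j C, measurable C -> P (X j @^-1` C) = D C) ->
  (forall y, measurable_fun setT (F y)) ->
  (forall u y, differentiable (F ^~ u) y) ->
  (forall y, differentiable f y) ->
  unbiased D (stoch_grad F) f -> strong_growth D (stoch_grad F) f rho ->
  1 <= rho -> (forall w, 0 <= c w) ->
  (forall j i, j \in js -> measurable_fun [set: other_space X j] (fun w => x w 0 i)) ->
  (forall j, j \in js -> measurable_fun [set: other_space X j] c) ->
  uniq js ->
  (\int[P]_w (c w * l2norm
      (\sum_(j <- js) (stoch_grad F (x w) (X j w) - gradient f (x w))) ^+ 2)%:E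
   <= \int[P]_w ((size js)%:R *
      ((rho - 1) * (c w * l2norm (gradient f (x w)) ^+ 2)))%:E)%E.
Proof.
move=> mX indep XD mF dF df unb sgc rho1 c0.
elim: js => [_ _ _|j js IH mx mc /= /andP[jjs ujs]].
  rewrite integral0_eq; last by move=> w _; rewrite big_nil l2norm0 expr0n mulr0.
  by apply: integral_ge0 => w _; rewrite mul0r.
have sub k : k \in js -> k \in j :: js by rewrite inE => ->; rewrite orbT.
have {}IH := IH (fun k i kjs => mx k i (sub k kjs)) (fun k kjs => mc k (sub k kjs)) ujs.
pose T : measurableType _ := other_space X j.
have {}mx i : measurable_fun [set: T] (fun w => x w 0 i).
  by apply: mx; rewrite mem_head.
have {}mc : measurable_fun [set: T] c by apply: mc; rewrite mem_head.
have mg i : measurable_fun [set: T] (fun w => gradient f (x w) 0 i).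
  apply: (@measurable_gradient _ _ _ T x (fun y _ => f y)) => //.
set S : Omega -> 'rV[R]_d := fun w =>
  \sum_(j <- js) (stoch_grad F (x w) (X j w) - gradient f (x w)) in IH *.
have mS i : measurable_fun [set: T] (fun w => S w 0 i).
  rewrite (_ : (fun w => _) = (fun w => \sum_(k <- js)
      (if k == j then 0 else stoch_grad F (x w) (X k w) 0 i - gradient f (x w) 0 i))).
    apply: measurable_sum => k; case: eqVneq => [_|kj]; first exact: measurable_cst.
    apply: measurable_funB => //; apply: measurable_stoch_grad => //.
    exact: measurable_other_sample.
  apply/funext => w; rewrite summxE; apply: eq_big_seq => k kjs.
  by case: eqP => [kj|_]; [rewrite -kj kjs in jjs|rewrite !mxE].
pose y w := (rho - 1) * (c w * l2norm (gradient f (x w)) ^+ 2).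
have my : measurable_fun [set: T] y.
  apply: measurable_funM => //; apply: measurable_funM => //.
  by apply: measurable_funX; exact: measurable_l2norm.
have mcS : measurable_fun [set: T] (fun w => c w * l2norm (S w) ^+ 2).
  apply: measurable_funM => //.
  by apply: measurable_funX; exact: measurable_l2norm.
have y0 w : 0 <= y w by rewrite mulr_ge0 ?subr_ge0// mulr_ge0// sqr_ge0.
have cS0 w : 0 <= c w * l2norm (S w) ^+ 2 by rewrite mulr_ge0// sqr_ge0.
under eq_integral do rewrite big_cons addrC -/(S _).
apply: (@le_trans _ _ (\int[P]_w ((c w * l2norm (S w) ^+ 2)%:E + (y w)%:E))%E).
  apply: (@integral_fresh_sample_le _ _ _ _ _ _ D _ X j
    (fun z => (c z.1 * l2norm (S z.1 + (stoch_grad F (x z.1) z.2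
       - gradient f (x z.1))) ^+ 2)%:E)) => //.
  - exact: XD.
  - apply/measurable_EFinP; apply: measurable_funM.
      by apply: (measurableT_comp mc); exact: measurable_fst.
    apply: measurable_funX; apply: measurable_l2norm => i.
    rewrite (_ : (fun z => _) = (fun z : T * Xi => S z.1 0 i
      + (stoch_grad F (x z.1) z.2 0 i - gradient f (x z.1) 0 i))); last first.
      by apply/funext => z; rewrite !mxE.
    apply: measurable_funD.
      by apply: (measurableT_comp (mS i)); exact: measurable_fst.
    apply: measurable_funB.
      apply: (@measurable_stoch_grad _ _ _ _ Xi _ F (fun z : T * Xi => x z.1)
        (fun z => z.2)) => //; last exact: measurable_snd.
      by move=> k; apply: (measurableT_comp (mx k)); exact: measurable_fst.
    by apply: (measurableT_comp (mg i)); exact: measurable_fst.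
  - by move=> z; rewrite lee_fin mulr_ge0// sqr_ge0.
  - by apply: emeasurable_funD; exact/measurable_EFinP.
  - move=> w /=; under eq_integral do rewrite EFinM.
    rewrite ge0_integralZl_EFin//; last 2 first.
    + by move=> s _; rewrite lee_fin sqr_ge0.
    + apply/measurable_EFinP; apply: measurable_funX; apply: measurable_l2norm => i.
      rewrite (_ : (fun s => _) = (fun s => S w 0 i
        + (stoch_grad F (x w) s 0 i - gradient f (x w) 0 i))); last first.
        by apply/funext => s; rewrite !mxE.
      apply: measurable_funD => //; apply: measurable_funB => //.
      exact: (@measurable_stoch_grad _ _ _ _ Xi Xi F (fun _ => x w) id).
    rewrite -EFinD (_ : _ + y w = c w * (l2norm (S w) ^+ 2
      + (rho - 1) * l2norm (gradient f (x w)) ^+ 2)); last by rewrite /y; ring.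
    rewrite EFinM; apply: lee_wpmul2l; first by rewrite lee_fin.
    exact: stoch_grad_second_moment.
have {}my : measurable_fun setT y by exact: (measurable_other_space mX my).
have {}mcS : measurable_fun setT (fun w => c w * l2norm (S w) ^+ 2).
  exact: (measurable_other_space mX mcS).
rewrite ge0_integralD//; last 4 first.
- by move=> w _; rewrite lee_fin.
- exact/measurable_EFinP.
- by move=> w _; rewrite lee_fin.
- exact/measurable_EFinP.
under [leRHS]eq_integral do rewrite -natr1 mulrDl mul1r -/(y _) EFinD.
rewrite ge0_integralD//; last 4 first.
- by move=> w _; rewrite lee_fin mulr_ge0.
- by apply/measurable_EFinP; apply: measurable_funM.
- by move=> w _; rewrite lee_fin.
- exact/measurable_EFinP.
by apply: leeD2r; exact: IH.
Qed.

(** The weight [c] is chosen so that [c * |B *: e| ^+ 2] equals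
    [4 * |e| ^+ 2 / (m + eps)], the quantity which the arithmetic-geometric mean
    inequality compares with [|e|]. *)
Lemma nsgd_batch_noise_le (R : realType) (d : nat) (dO dX : measure_display)
    (Omega : measurableType dO) (Xi : measurableType dX)
    (P : probability Omega R) (D : probability Xi R)
    (F : 'rV[R]_d -> Xi -> R) (f : 'rV[R]_d -> R)
    (rho lambda eta eps : R) (B : nat) (x0 : 'rV[R]_d)
    (xi : nat -> 'I_B -> {RV P >-> Xi}) (k : nat) (x : Omega -> 'rV[R]_d) :
  (forall y, measurable_fun setT (F y)) ->
  (forall u y, differentiable (F ^~ u) y) ->
  (forall y, differentiable f y) ->
  unbiased D (stoch_grad F) f -> strong_growth D (stoch_grad F) f rho ->
  1 <= rho -> 0 < lambda -> (0 < B)%N -> 64 * (rho - 1) <= B%:R ->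
  iid_samples D xi -> 0 < eps ->
  x = (fun w => nsgd (stoch_grad F) eta lambda x0 (fun j i => xi j i w) k) ->
  (\int[P]_w (l2norm (batch_mean (stoch_grad F) (fun i => xi k i w) (x w)
      - gradient f (x w)))%:E
   <= \int[P]_w (l2norm (gradient f (x w)) / 8 + eps / 16)%:E)%E.
Proof.
move=> mF dF df unb sgc rho1 l0 B0 Brho [indep law] eps0 xE.
pose X (ki : nat * 'I_B) : Omega -> Xi := xi ki.1 ki.2.
have mX ki : measurable_fun setT (X ki) by exact: measurable_funP.
pose m w := l2norm (gradient f (x w)).
pose e w := batch_mean (stoch_grad F) (fun i => xi k i w) (x w) - gradient f (x w).
have B0' : (0 : R) < B%:R by rewrite ltr0n.
have mpos w : 0 < m w + eps by rewrite ltr_wpDl ?l2norm_ge0.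
pose c w := 4 * B%:R^-1 ^+ 2 * (m w + eps)^-1.
have c0 w : 0 <= c w by rewrite !mulr_ge0// ?sqr_ge0// invr_ge0 ltW.
have mxo (i0 : 'I_B) i : measurable_fun [set: other_space X (k, i0)] (fun w => x w 0 i).
  rewrite xE.
  apply: (@measurable_nsgd _ _ _ _ Xi (other_space X (k, i0)) F B eta lambda x0
    (fun j i => xi j i : Omega -> Xi)) => // j i' jk.
  by apply: (@measurable_other_sample _ _ _ _ _ X (j, i')); rewrite xpair_eqE (ltn_eqF jk).
have mxO i : measurable_fun [set: Omega] (fun w => x w 0 i).
  by rewrite xE; apply: (@measurable_nsgd _ _ _ _ Xi Omega F B eta lambda x0
    (fun j i => xi j i : Omega -> Xi)).
have mm (i0 : 'I_B) : measurable_fun [set: other_space X (k, i0)] m.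
  apply: measurable_l2norm => i.
  by apply: (@measurable_gradient _ _ _ (other_space X (k, i0)) x (fun y _ => f y)).
have mc (i0 : 'I_B) : measurable_fun [set: other_space X (k, i0)] c.
  apply: measurable_funM => //; apply: measurable_ge0_inv => [w|]; first exact: ltW.
  exact: measurable_funD.
have mO : measurable_fun [set: Omega] m := measurable_other_space mX (mm (Ordinal B0)).
have cO : measurable_fun [set: Omega] c := measurable_other_space mX (mc (Ordinal B0)).
have meO : measurable_fun [set: Omega] (fun w => l2norm (e w)).
  apply: measurable_l2normB; first exact: measurable_batch_mean.
  exact: (@measurable_gradient _ _ _ Omega x (fun y _ => f y)).
pose js := [seq (k, i) | i <- enum 'I_B].
have js_sum w : \sum_(j <- js) (stoch_grad F (x w) (X j w) - gradient f (x w))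
    = B%:R *: e w.
  rewrite big_map big_enum/= big_split/= sumr_const card_ord.
  rewrite scalerBr scalerA divff ?gt_eqF// scale1r.
  by rewrite mulNrn -scaler_nat.
have js_k j : j \in js -> exists i, j = (k, i) by case/mapP => i _ ->; exists i.
have noise : (\int[P]_w (c w * l2norm (B%:R *: e w) ^+ 2)%:E
    <= \int[P]_w (m w / 16)%:E)%E.
  under eq_integral do rewrite -js_sum.
  apply: (@le_trans _ _ (\int[P]_w ((size js)%:R *
      ((rho - 1) * (c w * m w ^+ 2)))%:E)%E).
    apply: (weighted_noise_le (D := D)) => //.
    - by move=> j C mC; exact: law.
    - by move=> j i /js_k[i0 ->].
    - by move=> j /js_k[i0 ->].
    - by rewrite map_inj_uniq ?enum_uniq// => i j [].
  have mm0 w : 0 <= m w by exact: l2norm_ge0.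
  have mm2 : measurable_fun setT (fun w => (size js)%:R *
      ((rho - 1) * (c w * m w ^+ 2))).
    do 3 apply: measurable_funM => //; exact: measurable_funX.
  apply: ge0_le_integral => //.
  - by move=> w _; rewrite lee_fin; do 3 (rewrite mulr_ge0 ?subr_ge0//); exact: sqr_ge0.
  - exact/measurable_EFinP.
  - by apply/measurable_EFinP; exact: measurable_funM.
  - move=> w _; rewrite lee_fin size_map size_enum_ord /c.
    have mw : m w ^+ 2 / (m w + eps) <= m w.
      by rewrite ler_pdivrMr// expr2 ler_wpM2l// lerDl ltW.
    have mw0 : 0 <= m w ^+ 2 / (m w + eps) by rewrite divr_ge0 ?sqr_ge0// ltW.
    have rB : (rho - 1) / B%:R <= 64^-1.
      by rewrite ler_pdivrMr//; lra.
    have rB0 : 0 <= (rho - 1) / B%:R by rewrite divr_ge0 ?subr_ge0.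
    rewrite (_ : _ * _ = 4 * (((rho - 1) / B%:R) * (m w ^+ 2 / (m w + eps)))).
      have := ler_pM rB0 mw0 rB mw; lra.
    by field; rewrite !gt_eqF.
apply: (@le_trans _ _ (\int[P]_w ((c w * l2norm (B%:R *: e w) ^+ 2)%:E
   + ((m w + eps) / 16)%:E))%E).
  apply: ge0_le_integral => //.
  - by move=> w _; rewrite lee_fin l2norm_ge0.
  - exact/measurable_EFinP.
  - apply: emeasurable_funD; apply/measurable_EFinP.
      apply: measurable_funM => //; apply: measurable_funX.
      under eq_fun do rewrite l2normZ.
      exact: measurable_funM.
    by apply: measurable_funM => //; exact: measurable_funD.
  - move=> w _; rewrite -EFinD lee_fin l2normZ ger0_norm ?ler0n//.
    rewrite -/(e w) (_ : c w * _ = 4 * (l2norm (e w) ^+ 2) / (m w + eps)); last first.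
      by rewrite /c; field; rewrite !gt_eqF.
    (* [t * e <= 4 * e ^+ 2 + t ^+ 2 / 16] for [t := m w + eps] *)
    rewrite -(ler_pM2r (mpos w)) mulrDl divfK ?gt_eqF//.
    have := sqr_ge0 (8 * l2norm (e w) - (m w + eps)); lra.
rewrite ge0_integralD//; last 4 first.
- by move=> w _; rewrite lee_fin mulr_ge0// sqr_ge0.
- apply/measurable_EFinP; apply: measurable_funM => //; apply: measurable_funX.
  by under eq_fun do rewrite l2normZ; exact: measurable_funM.
- by move=> w _; rewrite lee_fin divr_ge0// ltW.
- by apply/measurable_EFinP; apply: measurable_funM => //; exact: measurable_funD.
apply: (le_trans (leeD2r _ noise)); rewrite -ge0_integralD//; last 4 first.
- by move=> w _; rewrite lee_fin divr_ge0// l2norm_ge0.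
- by apply/measurable_EFinP; exact: measurable_funM.
- by move=> w _; rewrite lee_fin divr_ge0// ltW.
- by apply/measurable_EFinP; apply: measurable_funM => //; exact: measurable_funD.
rewrite le_eqVlt; apply/orP; left; apply/eqP; apply: eq_integral => w _.
by rewrite -EFinD -/(m w); congr (_%:E); lra.
Qed.

(** * Summation over the iterations *)

Lemma nsgd_gradient_bounded (R : realType) (d : nat) (Xi : Type)
    (F : 'rV[R]_d -> Xi -> R) (f : 'rV[R]_d -> R) (L0 L1 lambda eta : R)
    (B : nat) (x0 : 'rV[R]_d) (k : nat) :
  L0L1_smooth L0 L1 f -> 0 <= L0 -> 0 <= L1 -> 0 < lambda -> 0 < eta ->
  eta * (L0 + L1 * lambda) <= lambda ->
  exists M, forall s : nat -> 'I_B -> Xi,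
    l2norm (gradient f (nsgd (stoch_grad F) eta lambda x0 s k)) <= M.
Proof.
move=> fs L00 L10 l0 e0 eK; elim: k => [|k [M IH]].
  by exists (l2norm (gradient f x0)).
exists (2 * M + lambda) => s /=.
apply: (le_trans (nsgd_step_gradient _ _ fs L00 L10 l0 e0 eK)).
by rewrite lerD2r ler_pM2l.
Qed.

Lemma nsgd_descent_sum (R : realType) (d : nat) (Xi : Type)
    (F : 'rV[R]_d -> Xi -> R) (f : 'rV[R]_d -> R) (L0 L1 lambda eta : R)
    (B : nat) (x0 : 'rV[R]_d) (s : nat -> 'I_B -> Xi) (N : nat) :
  (forall y, differentiable f y) -> L0L1_smooth L0 L1 f ->
  0 <= L0 -> 0 <= L1 -> 0 < lambda -> 0 < eta ->
  eta * (L0 + L1 * lambda) <= lambda ->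
  let x := nsgd (stoch_grad F) eta lambda x0 s in
  (f (x N) + \sum_(k < N) eta / 2 * l2norm (gradient f (x k)) <=
    f x0 + N%:R * (3 / 2 * (eta * lambda)) + \sum_(k < N) 2 * eta *
      l2norm (batch_mean (stoch_grad F) (s k) (x k) - gradient f (x k)) : Prop).
Proof.
move=> df fs L00 L10 l0 e0 eK x.
elim: N => [|N IH]; first by rewrite !big_ord0 !addr0 mul0r addr0.
have step : f (x N.+1) <= _ := nsgd_step_descent (x N)
  (batch_mean (stoch_grad F) (s N) (x N)) df fs L00 L10 l0 e0 eK.
rewrite !big_ord_recr/= -[N.+1%:R]natr1.
move: IH step; lra.
Qed.

Theorem theorem4p3 (R : realType) (d : nat)
  (dX dO : measure_display)
  (Xi : measurableType dX) (D : probability Xi R)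
  (Omega : measurableType dO) (P : probability Omega R)
  (F : 'rV[R]_d -> Xi -> R) (f : 'rV[R]_d -> R) (fstar : R)
  (L0 L1 rho lambda eta : R) (B N : nat) (x0 : 'rV[R]_d)
  (xi : nat -> 'I_B -> {RV P >-> Xi})
  (F_integrable : forall x, D.-integrable [set: Xi] (EFin \o F x))
  (fE : forall x, ((f x)%:E = 'E_D[F x])%E)
  (F_diff : forall s x, differentiable (fun y => F y s) x)
  (f_diff : forall x, differentiable f x)
  (fstar_attained : exists x, f x = fstar)
  (fstar_le : forall x, fstar <= f x)
  (L0_ge0 : 0 <= L0) (L1_ge0 : 0 <= L1)
  (f_smooth : L0L1_smooth L0 L1 f)
  (G_unbiased : unbiased D (stoch_grad F) f)
  (rho_ge1 : 1 <= rho)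
  (G_sgc : strong_growth D (stoch_grad F) f rho)
  (lambda_gt0 : 0 < lambda)
  (eta_gt0 : 0 < eta)
  (eta_le : (eta%:E <= lambda%:E / (L0 + L1 * lambda)%:E)%E)
  (B_ge1 : (1 <= B)%N)
  (B_ge : 64 * (rho - 1) <= B%:R)
  (N_ge1 : (1 <= N)%N)
  (xi_iid : iid_samples D xi) :
  let x (k : nat) (w : Omega) : 'rV[R]_d :=
    nsgd (stoch_grad F) eta lambda x0 (fun j i => xi j i w) k in
  let F0 : R := f x0 - fstar in
  (\big[mine/+oo]_(k < N) 'E_P[fun w => l2norm (gradient f (x k w))]
     <= (4 * F0 / (eta * N%:R) + 6 * lambda)%:E)%E.
Proof.
pose x k w := nsgd (stoch_grad F) eta lambda x0 (fun j i => xi j i w) k.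
pose F0 := f x0 - fstar.
change (is_true (\big[mine/+oo]_(k < N) 'E_P[fun w => l2norm (gradient f (x k w))]
     <= (4 * F0 / (eta * N%:R) + 6 * lambda)%:E)%E).
have mF y : measurable_fun setT (F y).
  by have /integrableP[/measurable_EFinP] := F_integrable y.
have dF u y : differentiable (F ^~ u) y := F_diff u y.
have eK := step_size_le L0_ge0 L1_ge0 lambda_gt0 eta_gt0 eta_le.
pose m k w := l2norm (gradient f (x k w)).
pose e k w := l2norm (batch_mean (stoch_grad F) (fun i => xi k i w) (x k w)
  - gradient f (x k w)).
have m0 k w : 0 <= m k w by exact: l2norm_ge0.
have e0 k w : 0 <= e k w by exact: l2norm_ge0.
have mx k i : measurable_fun [set: Omega] (fun w => x k w 0 i).
  by apply: (@measurable_nsgd _ _ _ _ Xi Omega F B eta lambda x0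
    (fun j i => xi j i : Omega -> Xi)).
have mgrad k i : measurable_fun [set: Omega] (fun w => gradient f (x k w) 0 i).
  exact: (@measurable_gradient _ _ _ Omega (x k) (fun y _ => f y)).
have mm k : measurable_fun [set: Omega] (m k) by exact: measurable_l2norm.
have me k : measurable_fun [set: Omega] (e k).
  by apply: measurable_l2normB => //; exact: measurable_batch_mean.
have P1 (r : R) : (\int[P]_w r%:E = r%:E)%E.
  rewrite integral_cst//.
  by rewrite [X in (_ * X)%E](_ : _ = 1%E) ?mule1//; exact: probability_setT.
(* each gradient norm is a bounded variable, so its mean is a real number *)
pose A k := fine (\int[P]_w (m k w)%:E)%E.
have AE k : (\int[P]_w (m k w)%:E = (A k)%:E)%E.
  rewrite fineK// ge0_fin_numE; last by apply: integral_ge0 => w _; rewrite lee_fin.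
  have [M hM] := @nsgd_gradient_bounded _ _ Xi F f _ _ _ _ B x0 k
    f_smooth L0_ge0 L1_ge0 lambda_gt0 eta_gt0 eK.
  apply: (@le_lt_trans _ _ M%:E); last exact: ltry.
  rewrite -P1; apply: ge0_le_integral => //.
  - by move=> w _; rewrite lee_fin.
  - exact/measurable_EFinP/(mm k).
  - by move=> w _; rewrite lee_fin; exact: hM.
have noise eps k : 0 < eps -> (\int[P]_w (e k w)%:E <= (A k / 8 + eps / 16)%:E)%E.
  move=> eps0.
  apply: (le_trans (nsgd_batch_noise_le mF dF f_diff G_unbiased G_sgc rho_ge1
    lambda_gt0 B_ge1 B_ge xi_iid eps0 (erefl (x k)))).
  under eq_integral do rewrite EFinD.
  rewrite ge0_integralD//; last 3 first.
  - by move=> w _; rewrite lee_fin divr_ge0// l2norm_ge0.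
  - by apply/measurable_EFinP; apply: measurable_funM => //; exact: (mm k).
  - by move=> w _; rewrite lee_fin divr_ge0// ltW.
  rewrite P1 EFinD; under eq_integral do rewrite mulrC EFinM.
  rewrite ge0_integralZl_EFin//; last 2 first.
  - by move=> w _; rewrite lee_fin l2norm_ge0.
  - exact/measurable_EFinP/(mm k).
  by rewrite AE -EFinM mulrC.
pose C := F0 + N%:R * (3 / 2 * (eta * lambda)).
have F0_ge0 : 0 <= F0 by rewrite subr_ge0.
have C0 : 0 <= C.
  by rewrite addr_ge0// !mulr_ge0// ltW.
(* the noise is kept on the right-hand side so that both sides are nonnegative *)
have path w : \sum_(k < N) eta / 2 * m k w <= C + \sum_(k < N) 2 * eta * e k w.
  have := @nsgd_descent_sum _ _ Xi F f _ _ _ _ B x0 (fun j i => xi j i w) N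
    f_diff f_smooth L0_ge0 L1_ge0 lambda_gt0 eta_gt0 eK.
  rewrite -/(x N w) => descent.
  have := fstar_le (x N w); move: descent; rewrite /C /F0; lra.
have integral_wsum (c : R) (u : nat -> Omega -> R) : 0 <= c ->
    (forall k w, 0 <= u k w) -> (forall k, measurable_fun setT (u k)) ->
    (\int[P]_w (\sum_(k < N) c * u k w)%:E =
     \sum_(k < N) c%:E * \int[P]_w (u k w)%:E)%E.
  move=> c0 u0 mu; under eq_integral do rewrite -sumEFin.
  rewrite ge0_integral_sum//; last 2 first.
  - by move=> k; apply/measurable_EFinP; exact: measurable_funM.
  - by move=> k w _; rewrite lee_fin mulr_ge0.
  apply: eq_bigr => k _; under eq_integral do rewrite EFinM.
  rewrite ge0_integralZl_EFin//; first by move=> w _; rewrite lee_fin.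
  exact/measurable_EFinP.
have eta2 : 0 <= eta / 2 by rewrite divr_ge0// ltW.
have two_eta : 0 <= 2 * eta by rewrite mulr_ge0// ltW.
have mean_sum eps : 0 < eps ->
    \sum_(k < N) eta / 2 * A k <= C + \sum_(k < N) 2 * eta * (A k / 8 + eps / 16).
  move=> eps0; rewrite -lee_fin EFinD -!sumEFin.
  apply: (@le_trans _ _ (\int[P]_w (C%:E + (\sum_(k < N) 2 * eta * e k w)%:E))%E).
    rewrite [leLHS](_ : _ = \int[P]_w (\sum_(k < N) eta / 2 * m k w)%:E)%E; last first.
      rewrite integral_wsum//; apply: eq_bigr => k _.
      by rewrite AE EFinM.
    apply: ge0_le_integral => //.
    - by move=> w _; rewrite lee_fin sumr_ge0// => k _; rewrite mulr_ge0.
    - apply/measurable_EFinP; apply: measurable_sum => k; exact: measurable_funM.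
    - apply: emeasurable_funD; first exact: measurable_cst.
      apply/measurable_EFinP; apply: measurable_sum => k; exact: measurable_funM.
    - by move=> w _; rewrite -EFinD lee_fin.
  rewrite ge0_integralD//; last 2 first.
  - by move=> w _; rewrite lee_fin sumr_ge0// => k _; rewrite mulr_ge0.
  - apply/measurable_EFinP; apply: measurable_sum => k; exact: measurable_funM.
  rewrite P1 integral_wsum//; apply: leeD2l; apply: lee_sum => k _.
  by rewrite [leRHS]EFinM; apply: lee_wpmul2l; [rewrite lee_fin|exact: noise].
have N0 : (0 : R) < N%:R by rewrite ltr0n.
pose T := 4 * F0 / (eta * N%:R) + 6 * lambda.
have sum_le : \sum_(k < N) A k <= N%:R * T.
  have eta4 : 0 < eta / 4 by rewrite divr_gt0.
  rewrite -(ler_pM2l eta4).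
  have -> : eta / 4 * (N%:R * T) = C by rewrite /T /C; field; rewrite !gt_eqF.
  apply/ler_addgt0Pr => del del0.
  (* the noise terms contribute [N * eta * eps / 8] in total *)
  have eps0 : 0 < 8 * del / (eta * N%:R) by rewrite divr_gt0 ?mulr_gt0.
  have := mean_sum _ eps0.
  rewrite -!mulr_sumr big_split/= -mulr_suml sumr_const card_ord -mulr_natl.
  set S := \sum_(k < N) A k.
  rewrite (_ : _ * (_ + _) = eta / 4 * S + del); last first.
    by field; rewrite !gt_eqF.
  lra.
have [k kT] : exists k : 'I_N, A k <= T.
  apply: contrapT => noT; move: sum_le; apply/negP; rewrite -ltNge.
  have -> : N%:R * T = \sum_(k < N) T by rewrite sumr_const card_ord mulr_natl.
  apply: ltr_sum; first by apply/hasP; exists (Ordinal N_ge1); rewrite ?mem_index_enum.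
  by move=> k _; rewrite ltNge; apply/negP => kT; apply: noT; exists k.
by apply: (bigmin_inf k) => //; rewrite unlock AE lee_fin.
Qed.
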